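(* Let $J\ge2$, let $\mu$ be counting measure on $\mathbb Z$, and let the data $X=(X_n)_{n\le N}$ come from the $J$-state hidden Markov model described in the context, with parameters satisfying Assumptions A2' and A3. Let $M_N$ be any sequence tending to infinity. Then there exist estimators $\hat f_1,\dots,\hat f_J$ (functions of $X$) and a permutation $\tau$ of $\{1,\dots,J\}$ such that for each $j\le J$, $$\Pi_H\big(\|\hat f_j-f_{\tau(j)}\|_\infty\ge M_NN^{-1/2}\big)\to0\quad\text{as }N\to\infty.$$
   Context: $J$-state hidden Markov model: $\theta=(\theta_n)_{n\le N}$ is a Markov chain on $\{1,\dots,J\}$ with transition matrix $Q$ ($J\times J$) and initial distribution $\pi$; conditionally on $\theta$, $X_1,\dots,X_N$ are independent and $X_n$ has density $f_{\theta_n}$ with respect to $\mu$ (the emission densities $f_1,\dots,f_J$). $\Pi_H$ denotes the law for $H=(Q,\pi,f_1,\dots,f_J)$; $\|\cdot\|_\infty$ is the supremum norm. Assumption A2': $Q$ has full rank, the chain is irreducible and aperiodic, and $\theta_1$ follows the invariant distribution $\pi$. Assumption A3: $f_1,\dots,f_J$ are linearly independent. *)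

(* Defs.v *)
From HB Require Import structures.
From mathcomp Require Import all_boot all_order all_algebra all_fingroup.
From mathcomp Require Import all_classical all_reals all_analysis.
Set Implicit Arguments. Unset Strict Implicit. Unset Printing Implicit Defensive.
Import Order.TTheory GRing.Theory Num.Theory.
Import numFieldNormedType.Exports.
Local Open Scope classical_set_scope.
Local Open Scope ring_scope.

Section HMM.
Variables (R : realType) (J : nat).

Definition stochastic (Q : 'M[R]_J) : Prop :=
  (forall i j, 0 <= Q i j) /\ (forall i, \sum_j Q i j = 1).

Definition full_rank (Q : 'M[R]_J) : Prop := \rank Q = J.

Definition irreducible (Q : 'M[R]_J) : Prop :=
  forall i j : 'I_J, exists n : nat, 0 < (Q ^+ n) i j.

Definition aperiodic (Q : 'M[R]_J) : Prop :=
  forall (i : 'I_J) (d : nat),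
    (forall n : nat, (0 < n)%N -> 0 < (Q ^+ n) i i -> (d %| n)%N) -> d = 1%N.

Definition invariant_distribution (Q : 'M[R]_J) (pi : 'rV[R]_J) : Prop :=
  (forall i, 0 <= pi 0 i) /\ \sum_i pi 0 i = 1 /\ pi *m Q = pi.

Definition is_pmf_Z (g : int -> R) : Prop :=
  (forall z, 0 <= g z) /\ (\esum_(z in [set: int]) (g z)%:E = 1%E).

Definition lin_indep (f : 'I_J -> int -> R) : Prop :=
  forall c : 'I_J -> R, (forall z, \sum_j c j * f j z = 0) -> forall j, c j = 0.

Definition assumption_A2' (Q : 'M[R]_J) (pi : 'rV[R]_J) : Prop :=
  [/\ stochastic Q, full_rank Q, irreducible Q, aperiodic Q
    & invariant_distribution Q pi].

Definition assumption_A3 (f : 'I_J -> int -> R) : Prop :=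
  (forall j, is_pmf_Z (f j)) /\ lin_indep f.

Fixpoint chain_weight (Q : 'M[R]_J) (a : 'I_J) (s : seq 'I_J) : R :=
  if s is b :: s' then Q a b * chain_weight Q b s' else 1.

Definition markov_weight (Q : 'M[R]_J) (pi : 'rV[R]_J) (s : seq 'I_J) : R :=
  if s is a :: s' then pi 0 a * chain_weight Q a s' else 1.

Definition hmm_pmf (Q : 'M[R]_J) (pi : 'rV[R]_J) (f : 'I_J -> int -> R)
  (N : nat) (x : N.-tuple int) : R :=
  \sum_(th : N.-tuple 'I_J)
     markov_weight Q pi th * \prod_(n < N) f (tnth th n) (tnth x n).

Definition hmm_prob (Q : 'M[R]_J) (pi : 'rV[R]_J) (f : 'I_J -> int -> R)
  (N : nat) (A : set (N.-tuple int)) : \bar R :=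
  \esum_(x in A) (hmm_pmf Q pi f x)%:E.

End HMM.

Definition supnorm (R : realType) (g : int -> R) : \bar R :=
  ereal_sup (range (fun z => (`|g z|)%:E)).

(* Main.v *)
Require Import Defs.
From HB Require Import structures.
From mathcomp Require Import all_boot all_order all_algebra all_fingroup.
From mathcomp Require Import all_classical all_reals all_analysis.
From mathcomp Require Import zify ring lra.
Set Implicit Arguments. Unset Strict Implicit. Unset Printing Implicit Defensive.
Import Order.TTheory GRing.Theory Num.Theory.
Import numFieldNormedType.Exports.
Local Open Scope classical_set_scope.
Local Open Scope ring_scope.

(* The observed law determines the emission densities through the joint law of
   three consecutive observations, which is the rank-J tensor
   [sum_j a_j(x) f_j(y) c_j(z)], where [a] and [c] are linearly independent because
   Q is invertible and pi is positive.  A minimum-distance argument replaces the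
   spectral algorithm: the estimator is the middle factor of any bounded rank-J
   tensor within [tolerance M N] of the empirical frequencies.

   Two facts make it work.  (i) The empirical frequency of a pattern of probability p
   has variance O(p/N): the sum of covariances telescopes through the fundamental
   matrix of the chain.  The p's sum to a constant, so Chebyshev and a union bound
   control all patterns simultaneously at rate N^{-1/2}.  (ii) If two bounded
   rank-J tensors are d-close, together with their marginals in (x, z), and one of
   them has independent factors, then their middle factors agree up to O(d),
   uniformly in y and up to relabelling.

   Labels are fixed by sorting the estimated densities lexicographically with a
   slack that vanishes slower than the estimation error, so the relabelling does not
   depend on N.  The unknown constants are absorbed by taking
   [sqrt(M_N)], capped at [N^{1/4}], in place of [M_N] in the tolerance. *)

(** * Sums over trajectories *)

Lemma esumZl (R : realType) (T : choiceType) (A : set T) (c : R) (a : T -> \bar R) :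
  0 <= c -> (forall t, 0 <= a t)%E ->
  (\esum_(t in A) (c%:E * a t) = c%:E * \esum_(t in A) a t)%E.
Proof.
move=> c0 a0; rewrite /esum.
rewrite -ereal_supZl//; last first.
  by apply/set0P; exists 0%E, set0; [exact: fsets_set0|rewrite fsbig_set0].
congr ereal_sup; apply/seteqP; split => [_ [X XA <-]|_ [_ [X XA <-] <-]] /=.
- by exists (\sum_(x \in X) a x)%E; [exists X|rewrite ge0_mule_fsumr].
- by exists X => //; rewrite ge0_mule_fsumr.
Qed.

Lemma esum_prod (R : realType) (T : choiceType) N (g : 'I_N -> T -> R) (c : 'I_N -> R) :
  (forall n z, 0 <= g n z) ->
  (forall n, \esum_(z in [set: T]) (g n z)%:E = (c n)%:E) ->
  \esum_(x in [set: N.-tuple T]) (\prod_n g n (tnth x n))%:E = (\prod_n c n)%:E.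
Proof.
elim: N g c => [|N IH] g c g0 gc.
  rewrite (_ : [set: 0.-tuple T] = [set [tuple]]); last first.
    by apply/seteqP; split => // x _ /=; apply: val_inj; rewrite /= tuple0.
  by rewrite esum_set1 !big_ord0 ?lee01.
pose e (p : T * N.-tuple T) := [tuple of p.1 :: p.2].
rewrite (@reindex_esum _ _ _ (setT `*`` (fun=> setT)) _ e); last first.
  split => //.
  - move=> [z x] [z' x'] _ _ /(congr1 val)/= [-> E].
    by congr (_, _); apply: val_inj.
  - move=> x _; exists (thead x, [tuple of behead x]) => //.
    by rewrite /e/= -tuple_eta.
rewrite -(@esum_esum _ _ _ _ _
  (fun (z : T) (x : N.-tuple T) => (\prod_n g n (tnth [tuple of z :: x] n))%:E)); last first.
  by move=> z x _ _; rewrite lee_fin prodr_ge0.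
transitivity (\esum_(z in [set: T]) ((\prod_(i < N) c (lift ord0 i))%:E * (g ord0 z)%:E)%E).
  apply: eq_esum => z _.
  transitivity (\esum_(x in [set: N.-tuple T])
     ((g ord0 z)%:E * (\prod_n g (lift ord0 n) (tnth x n))%:E)%E).
    apply: eq_esum => x _; rewrite big_ord_recl -EFinM tnth0; congr (_ * _)%:E.
    by apply: eq_bigr => i _; rewrite tnthS.
  rewrite esumZl// => [|x]; last by rewrite lee_fin prodr_ge0.
  rewrite (IH (fun n => g (lift ord0 n)) (fun n => c (lift ord0 n)))//.
  by rewrite muleC.
rewrite esumZl; first by rewrite gc -EFinM mulrC [in RHS]big_ord_recl.
- apply: prodr_ge0 => i _; rewrite -lee_fin -gc; apply: esum_ge0 => z _.
  by rewrite lee_fin.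
- by move=> z; rewrite lee_fin.
Qed.

(** * Weighted sums over hidden paths as matrix products *)

Section Chain.
Variables (R : realType) (J : nat) (Q : 'M[R]_J) (pi : 'rV[R]_J).

(** Given the hidden path the coordinates are independent, so they can be summed out one by one. The
    alphabet is general: [int] serves for expectations of patterns, [option int] for the total mass
    of all patterns. *)
Lemma esum_markov (T : choiceType) N (g : 'I_N -> 'I_J -> T -> R) (c : 'I_N -> 'I_J -> R) :
  (forall i j, 0 <= Q i j) -> (forall i, 0 <= pi 0 i) ->
  (forall n j z, 0 <= g n j z) ->
  (forall n j, \esum_(z in [set: T]) (g n j z)%:E = (c n j)%:E) ->
  \esum_(x in [set: N.-tuple T])
    (\sum_(th : N.-tuple 'I_J) markov_weight Q pi th *
       \prod_n g n (tnth th n) (tnth x n))%:E =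
  (\sum_(th : N.-tuple 'I_J) markov_weight Q pi th * \prod_n c n (tnth th n))%:E.
Proof.
move=> Q0 pi0 g0 gc.
have cw0 a s : 0 <= chain_weight Q a s.
  by elim: s a => //= b s IH a; rewrite mulr_ge0.
have mw0 s : 0 <= markov_weight Q pi s by case: s => //= a s; rewrite mulr_ge0.
transitivity (\esum_(x in [set: N.-tuple T])
  (\sum_(th : N.-tuple 'I_J) (markov_weight Q pi th)%:E *
     (\prod_n g n (tnth th n) (tnth x n))%:E)%E).
  by apply: eq_esum => x _; rewrite -sumEFin; apply: eq_bigr => th _; rewrite EFinM.
rewrite esum_sum; last by move=> x th _ _; rewrite mule_ge0 ?lee_fin// prodr_ge0.
rewrite -sumEFin; apply: eq_bigr => th _.
rewrite esumZl//; last by move=> x; rewrite lee_fin prodr_ge0.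
rewrite (@esum_prod _ _ _ (fun n => g n (tnth th n)) (fun n => c n (tnth th n)))//.
Qed.

(** The product Q D1 Q D2 ... Q Dm, with Di the diagonal matrix of the i-th weight. Putting [Q] in
    front of each weight turns concatenation into a matrix product; the first factor is absorbed by
    [pi *m Q = pi]. *)
Fixpoint chain_mx (ds : seq ('I_J -> R)) : 'M[R]_J :=
  if ds is d :: ds' then Q *m (diag_mx (\row_j d j) *m chain_mx ds') else 1%:M.

Let ones : 'cV[R]_J := const_mx 1.

Lemma big_tupleS (I : finType) N (F : seq I -> R) :
  \sum_(s : N.+1.-tuple I) F s = \sum_(i : I) \sum_(s : N.-tuple I) F (i :: s).
Proof.
rewrite pair_big/=.
rewrite (reindex (fun p : I * N.-tuple I => [tuple of p.1 :: p.2]))//=.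
exists (fun s => (thead s, [tuple of behead s])) => [[i s] _|s _] /=.
  by congr (_, _); apply: val_inj.
by rewrite -tuple_eta.
Qed.

Lemma chain_weight_sum (ds : seq ('I_J -> R)) a :
  \sum_(s : (size ds).-tuple 'I_J) chain_weight Q a s *
     \prod_(n < size ds) nth (fun=> 1) ds n (nth a s n) = (chain_mx ds *m ones) a 0.
Proof.
elim: ds a => [|d ds IH] a.
  rewrite (big_pred1 [tuple]) => [|s]; last by rewrite [s in RHS]tuple0 /= eqxx.
  by rewrite big_ord0 mulr1 mul1mx mxE.
rewrite (@big_tupleS _ _ (fun s => chain_weight Q a s *
     \prod_(n < size (d :: ds)) nth (fun=> 1) (d :: ds) n (nth a s n))).
rewrite [chain_mx _]/= -!mulmxA mxE.
apply: eq_bigr => j _; rewrite mul_diag_mx mxE [(\row__ _) 0 j]mxE -IH !mulr_sumr.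
apply: eq_bigr => s _.
rewrite big_ord_recl /= -!mulrA; congr (_ * _).
rewrite [RHS]mulrCA; congr (_ * (_ * _)); apply: eq_bigr => i _.
by rewrite !add0n (set_nth_default j a)// size_tuple ltn_ord.
Qed.

Lemma markov_weight_sum N (ds : seq ('I_J -> R)) :
  pi *m Q = pi -> \sum_i pi 0 i = 1 -> size ds = N ->
  \sum_(s : N.-tuple 'I_J) markov_weight Q pi s *
     \prod_(n < N) nth (fun=> 1) ds n (tnth s n) = (pi *m chain_mx ds *m ones) 0 0.
Proof.
move=> piQ pi1 <-; case: ds => [|d ds].
  rewrite (big_pred1 [tuple]) => [|s]; last by rewrite [s in RHS]tuple0 /= eqxx.
  rewrite big_ord0 mulr1 mulmx1/= mxE -[LHS]pi1.
  by apply: eq_bigr => i _; rewrite mxE mulr1.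
rewrite [chain_mx _]/= mulmxA piQ -!mulmxA mxE.
transitivity (\sum_(s : (size ds).+1.-tuple 'I_J)
   if (s : seq 'I_J) is a :: s' then pi 0 a * chain_weight Q a s' *
     (d a * \prod_(n < size ds) nth (fun=> 1) ds n (nth a s' n)) else 0).
  apply: eq_bigr => s _; case/tupleP: s => a s; rewrite big_ord_recl /= tnth0.
  congr (_ * (_ * _)); apply: eq_bigr => i _.
  by rewrite tnthS (tnth_nth a).
rewrite (@big_tupleS _ _ (fun s => if s is a :: s' then pi 0 a * chain_weight Q a s' *
     (d a * \prod_(n < size ds) nth (fun=> 1) ds n (nth a s' n)) else 0)).
apply: eq_bigr => j _; rewrite mul_diag_mx mxE [(\row__ _) 0 j]mxE -chain_weight_sum.
rewrite !mulr_sumr.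
by apply: eq_bigr => s _; rewrite -!mulrA; congr (_ * _); rewrite mulrCA.
Qed.

Lemma chain_mx_cat ds1 ds2 : chain_mx (ds1 ++ ds2) = chain_mx ds1 *m chain_mx ds2.
Proof. by elim: ds1 => [|d ds1 IH] /=; rewrite ?mul1mx// IH !mulmxA. Qed.

Lemma chain_mx1 m : chain_mx (nseq m (fun=> 1)) = Q ^+ m.
Proof.
elim: m => [|m IH] //=; rewrite IH exprS -mulmxE; congr (_ *m _).
rewrite (_ : diag_mx _ = 1%:M) ?mul1mx//.
by apply/matrixP => i j; rewrite !mxE.
Qed.

End Chain.

(** * Ergodic sums *)

Section Ergodic.
Variables (R : realType) (J : nat) (Q : 'M[R]_J) (pi : 'rV[R]_J).
Hypotheses (sQ : stochastic Q) (iQ : irreducible Q)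
  (ipi : invariant_distribution Q pi).

Lemma stochastic_mul1 m : Q ^+ m *m const_mx 1 = const_mx 1 :> 'cV[R]_J.
Proof.
elim: m => [|m IH]; first by rewrite expr0 mul1mx.
rewrite exprSr -mulmxE -mulmxA -[RHS]IH; congr (_ *m _).
apply/colP => i; rewrite !mxE -[RHS](sQ.2 i).
by apply: eq_bigr => j _; rewrite mxE mulr1.
Qed.

Lemma stochastic_exp m : stochastic (Q ^+ m).
Proof.
split=> [i j|i].
  elim: m i j => [|m IH] i j; first by rewrite expr0 mxE ler0n.
  by rewrite exprS -mulmxE mxE sumr_ge0// => k _; rewrite mulr_ge0// sQ.1.
have /colP/(_ i) := stochastic_mul1 m; rewrite mxE [RHS]mxE => <-.
by apply: eq_bigr => j _; rewrite mxE mulr1.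
Qed.

Lemma invariant_exp m : pi *m Q ^+ m = pi.
Proof.
elim: m => [|m IH]; first by rewrite expr0 mulmx1.
by rewrite exprSr -mulmxE mulmxA IH ipi.2.2.
Qed.

(** Some state carries mass, irreducibility moves part of it to [j] in [m] steps, and [pi] is fixed
    by [Q ^+ m]. *)
Lemma invariant_gt0 j : 0 < pi 0 j.
Proof.
have [i pi_i] : exists i, 0 < pi 0 i.
  apply: contrapT => /forallNP pi0.
  have : \sum_i pi 0 i = 0.
    apply: big1 => i _; apply/eqP; rewrite eq_le ipi.1 andbT.
    by rewrite leNgt; apply/negP/pi0.
  by rewrite ipi.2.1 => /eqP; rewrite oner_eq0.
have [m Qm] := iQ i j.
rewrite -(invariant_exp m) mxE (bigD1 i)//= ltr_pwDl ?mulr_gt0//.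
by apply: sumr_ge0 => k _; rewrite mulr_ge0 ?ipi.1 ?(stochastic_exp m).1.
Qed.

(** Maximum principle: at a state where [v] is largest, [v] is an average under [Q ^+ m] of values
    no larger, so the maximum is attained at every reachable state. *)
Lemma harmonic_const (v : 'cV[R]_J) : Q *m v = v -> forall i j, v i 0 = v j 0.
Proof.
move=> Qv.
have Qmv m : Q ^+ m *m v = v.
  by elim: m => [|m IH]; rewrite ?expr0 ?mul1mx// exprSr -mulmxE -mulmxA Qv.
suff H (i0 : 'I_J) : (forall j, v j 0 <= v i0 0) -> forall j, v j 0 = v i0 0.
  move=> i j; pose i0 := [arg max_(k > i) v k 0]%O.
  have Hi0 k : v k 0 <= v i0 0.
    by rewrite /i0; case: Order.TotalTheory.arg_maxP => // l _; apply.
  by rewrite !(H i0).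
move=> vmax j; have [m Qm] := iQ i0 j.
have /eqP : \sum_k (Q ^+ m) i0 k * (v i0 0 - v k 0) = 0.
  under eq_bigr do rewrite mulrBr.
  rewrite sumrB -mulr_suml (stochastic_exp m).2 mul1r -[in X in X - _](Qmv m).
  by rewrite mxE subrr.
rewrite psumr_eq0 => [/allP/(_ j)|k _]; last first.
  by rewrite mulr_ge0 ?(stochastic_exp m).1// subr_ge0.
by rewrite mem_index_enum mulf_eq0 (gt_eqF Qm)/= subr_eq0 => /(_ isT)/eqP.
Qed.

Let ones_pi : 'M[R]_J := const_mx 1 *m pi.
(** The inverse of this matrix is the fundamental matrix of the chain; the rank-one term compensates
    for the kernel of [1%:M - Q], made of the constant vectors. *)
Let fund : 'M[R]_J := 1%:M - Q + ones_pi.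

Lemma pi_ones : pi *m const_mx 1 = 1%:M :> 'M[R]_1.
Proof.
apply/rowP => i; rewrite !ord1 mxE [RHS]mxE eqxx -[RHS]ipi.2.1.
by apply: eq_bigr => j _; rewrite mxE mulr1.
Qed.

Lemma pi_fund : pi *m fund = pi.
Proof.
by rewrite mulmxDr mulmxBr mulmx1 ipi.2.2 subrr add0r mulmxA pi_ones mul1mx.
Qed.

Lemma fund_unit : fund \in unitmx.
Proof.
suff inj (v : 'cV[R]_J) : fund *m v = 0 -> v = 0.
  rewrite -unitmx_tr -row_free_unit -kermx_eq0; apply/eqP/row_matrixP => i.
  rewrite row0; apply: trmx_inj; rewrite trmx0; apply: inj.
  by apply: trmx_inj; rewrite trmx_mul trmxK -row_mul mulmx_ker row0 trmx0.
(* Multiplying by [pi] on the left gives [pi *m v = 0]; then [v] is harmonic, hence constant, hence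
   equal to its mean [pi *m v]. *)
move=> Fv; have piv : pi *m v = 0 by rewrite -pi_fund -mulmxA Fv mulmx0.
have Qv : Q *m v = v.
  move: Fv; rewrite mulmxDl -mulmxA piv mulmx0 addr0 mulmxBl mul1mx => /eqP.
  by rewrite subr_eq0 => /eqP.
apply/colP => i; rewrite [RHS]mxE; move/colP/(_ 0): piv.
rewrite mxE [RHS]mxE => <-.
transitivity ((\sum_j pi 0 j) * v i 0); first by rewrite ipi.2.1 mul1r.
by rewrite mulr_suml; apply: eq_bigr => j _; rewrite (harmonic_const Qv i j).
Qed.

(* No mixing rate is needed: with Z the fundamental matrix, the centred vectors
   [Q^m v - pi v] equal [Q^m (Z v) - Q^(m+1) (Z v)] and telescope. *)
Lemma ergodic_sum_bounded : exists2 C : R, 0 <= C &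
  forall (v : 'cV[R]_J), (forall i, 0 <= v i 0 <= 1) -> forall k a,
  `|\sum_(m < k) ((Q ^+ m *m v) a 0 - (pi *m v) 0 0)| <= C.
Proof.
pose Z := invmx fund; pose b := \sum_i \sum_j `|Z i j|.
have b0 : 0 <= b by rewrite !sumr_ge0// => i _; rewrite sumr_ge0.
exists (b + b); first by rewrite addr_ge0.
move=> v v01 k a; pose w := Z *m v.
have piZ : pi *m Z = pi by rewrite -[in LHS]pi_fund mulmxK// fund_unit.
have wb i : `|w i 0| <= b.
  rewrite mxE (le_trans (ler_norm_sum _ _ _))// /b [leRHS](bigD1 i)//=.
  rewrite -[leLHS]addr0 lerD//.
    apply: ler_sum => j _; have /andP[v0 v1] := v01 j.
    by rewrite normrM (ger0_norm v0) ler_piMr.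
  by rewrite sumr_ge0// => l _; rewrite sumr_ge0.
have QZ : w - Q *m w = v - const_mx 1 *m (pi *m v).
  have : fund *m w = v by rewrite mulmxA mulmxV ?fund_unit// mul1mx.
  rewrite mulmxDl mulmxBl mul1mx -mulmxA [pi *m _]mulmxA piZ => Ev.
  by rewrite -{1}Ev addrK.
have ones (x : 'M[R]_1) : ((const_mx 1 : 'cV[R]_J) *m x) a 0 = x 0 0.
  by rewrite mxE big_ord1 mxE mul1r.
have E m : (Q ^+ m *m v) a 0 - (pi *m v) 0 0 =
    - ((Q ^+ m.+1 *m w) a 0 - (Q ^+ m *m w) a 0).
  have : Q ^+ m *m (w - Q *m w) = Q ^+ m *m v - const_mx 1 *m (pi *m v).
    by rewrite QZ mulmxBr [_ *m (const_mx 1 *m _)]mulmxA stochastic_mul1.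
  rewrite mulmxBr [Q ^+ m *m (Q *m w)]mulmxA (_ : Q ^+ m *m Q = Q ^+ m.+1); last by rewrite exprSr -mulmxE.
  move=> /colP/(_ a); rewrite [LHS]mxE [X in _ + X]mxE [RHS]mxE [X in _ = _ + X]mxE.
  by rewrite ones opprB => <-.
under eq_bigr do rewrite E.
(* Only the two end terms survive: an entry of [w] and an average of entries of [w] under [Q ^+ k],
   each at most [b]. *)
rewrite sumrN normrN -(big_mkord xpredT (fun m => (Q ^+ m.+1 *m w) a 0 - (Q ^+ m *m w) a 0)).
rewrite telescope_sumr// expr0 mul1mx (le_trans (ler_normB _ _))// lerD//.
rewrite mxE (le_trans (ler_norm_sum _ _ _))//.
rewrite -[leRHS]mul1r -((stochastic_exp k).2 a) mulr_suml.
apply: ler_sum => j _; rewrite normrM ger0_norm ?(stochastic_exp k).1//.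
by rewrite ler_wpM2l// (stochastic_exp k).1.
Qed.

End Ergodic.

(** * Fluctuations of empirical frequencies *)

Section Patterns.
Variable R : realType.

Definition cell (o : option int) (z : int) : R := if o is Some y then (z == y)%:R else 1.

(* [None] is a wildcard; cells lying beyond the end of [x] are ignored. *)
Fixpoint pattern (os : seq (option int)) (x : seq int) : R :=
  if os is o :: os' then if x is z :: x' then cell o z * pattern os' x' else 1 else 1.

Lemma cell_ge0 o z : 0 <= cell o z.
Proof. by case: o => [y|] /=; rewrite ?ler0n. Qed.

Lemma cell_le1 o z : cell o z <= 1.
Proof. by case: o => [y|] //=; case: eqP. Qed.

Lemma pattern_ge0 os x : 0 <= pattern os x.
Proof. by elim: os x => [|o os IH] [|z x] //=; rewrite mulr_ge0 ?cell_ge0. Qed.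

Lemma pattern_le1 os x : pattern os x <= 1.
Proof.
elim: os x => [|o os IH] [|z x] //=.
by rewrite mulr_ile1 ?cell_ge0 ?pattern_ge0 ?cell_le1.
Qed.

Lemma pattern_cat os1 os2 x :
  pattern (os1 ++ os2) x = pattern os1 x * pattern os2 (drop (size os1) x).
Proof.
elim: os1 x => [|o os1 IH] [|z x] /=; rewrite ?mul1r ?drop0//.
  by case: os2 {IH} => //= *; rewrite ?mulr1.
by rewrite IH mulrA.
Qed.

Lemma pattern_None m x : pattern (nseq m None) x = 1.
Proof. by elim: m x => [|m IH] [|z x] //=; rewrite IH mulr1. Qed.

Lemma pattern_big N os (x : N.-tuple int) : size os = N ->
  pattern os x = \prod_(n < N) cell (nth None os n) (tnth x n).
Proof.
elim: N os x => [|N IH] [|o os] // x; first by rewrite big_ord0.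
case: (tupleP x) => z {}x [sz]; rewrite big_ord_recl /= IH// tnth0.
by congr (_ * _); apply: eq_bigr => i _; rewrite tnthS.
Qed.

End Patterns.

Lemma esum_option (R : realType) (T : choiceType) (a : option T -> \bar R) :
  (forall o, 0 <= a o)%E ->
  (\esum_(o in [set: option T]) a o = a None + \esum_(z in [set: T]) a (Some z))%E.
Proof.
move=> a0; rewrite (@esumID _ _ [set None]) ?setTI//; congr (_ + _)%E.
  by rewrite esum_set1.
rewrite (_ : ~` [set None] = Some @` [set: T]); last first.
  by apply/seteqP; split => [[z|] //= _|_ [z _ <-]//]; exists z.
by rewrite esum_image// => z z' _ _ [].
Qed.

(** Shape of a variance bound: [r] holds second moments, [q] the squared mean, and [e] bounds the
    covariances of an index with all earlier ones. The induction adds a last row and column, equal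
    by symmetry, and a diagonal term. *)
Lemma double_sum_le (R : realType) (r : nat -> nat -> R) (p q e : R) n :
  (forall s t, r s t = r t s) -> (forall s, (s < n)%N -> r s s <= p) -> 0 <= q ->
  (forall t, (t < n)%N -> \sum_(s < t) (r s t - q) <= e) ->
  \sum_(s < n) \sum_(t < n) r s t <= n%:R ^+ 2 * q + n%:R * (2 * e + p).
Proof.
move=> rC rp q0 re.
suff : \sum_(s < n) \sum_(t < n) (r s t - q) <= n%:R * (2 * e + p).
  under eq_bigr do rewrite sumrB sumr_const card_ord.
  by rewrite sumrB sumr_const card_ord -mulrnA -[q *+ _]mulr_natl natrM; lra.
elim: n rp re => [|n IH] rp re; first by rewrite big_ord0 mul0r.
under eq_bigr do rewrite big_ord_recr /=.
rewrite big_split big_ord_recr /= big_ord_recr /=.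
have IHn := IH (fun t tn => rp t (ltnW tn)) (fun t tn => re t (ltnW tn)); have ren := re n (ltnSn n).
have -> : \sum_(i < n) (r n i - q) = \sum_(i < n) (r i n - q).
  by apply: eq_bigr => i _; rewrite rC.
have rnn := rp n (ltnSn n); rewrite -natr1; lra.
Qed.

Section Variance.
Variables (R : realType) (J : nat) (Q : 'M[R]_J) (pi : 'rV[R]_J) (f : 'I_J -> int -> R).
Hypotheses (sQ : stochastic Q) (iQ : irreducible Q)
  (ipi : invariant_distribution Q pi) (fpmf : forall j, is_pmf_Z (f j)).

Definition expect N (phi : N.-tuple int -> R) : \bar R :=
  \esum_(x in [set: N.-tuple int]) (hmm_pmf Q pi f x * phi x)%:E.

Definition emission (o : option int) (j : 'I_J) : R := if o is Some y then f j y else 1.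

Definition pattern_prob (os : seq (option int)) : R :=
  (pi *m chain_mx Q (map emission os) *m (const_mx 1 : 'cV_J)) 0 0.

Lemma pmf_le1 j y : f j y <= 1.
Proof.
rewrite -lee_fin -[leRHS](fpmf j).2 (esumID [set y]) ?setTI; last first.
  by move=> z _; rewrite lee_fin (fpmf j).1.
rewrite esum_set1 ?lee_fin ?(fpmf j).1// leeDl//.
by apply: esum_ge0 => z _; rewrite lee_fin (fpmf j).1.
Qed.

Lemma emission_ge0 o j : 0 <= emission o j.
Proof. by case: o => //= y; exact: (fpmf j).1. Qed.

Lemma emission_le1 o j : emission o j <= 1.
Proof. by case: o => //= y; exact: pmf_le1. Qed.

Lemma emission_esum o j :
  \esum_(z in [set: int]) (f j z * cell R o z)%:E = (emission o j)%:E.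
Proof.
case: o => [y|] /=; last first.
  by rewrite -[RHS](fpmf j).2; apply: eq_esum => z _; rewrite mulr1.
rewrite (esumID [set y]) ?setTI; last first.
  by move=> z _; rewrite lee_fin mulr_ge0 ?(fpmf j).1.
rewrite esum_set1 ?lee_fin ?mulr_ge0 ?(fpmf j).1// eqxx mulr1 esum1 ?adde0// => z /= /eqP.
by move=> /negPf ->; rewrite mulr0.
Qed.

Lemma markov_weight_ge0 s : 0 <= markov_weight Q pi s.
Proof.
case: s => //= a s; rewrite mulr_ge0 ?ipi.1//.
by elim: s a => //= b s IH a; rewrite mulr_ge0 ?sQ.1.
Qed.

Lemma hmm_pmf_ge0 N (x : N.-tuple int) : 0 <= hmm_pmf Q pi f x.
Proof.
apply: sumr_ge0 => th _; rewrite mulr_ge0 ?markov_weight_ge0// prodr_ge0// => i _.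
exact: (fpmf _).1.
Qed.

Lemma chain_mx_ge0 os i j : 0 <= chain_mx Q (map emission os) i j.
Proof.
elim: os i j => [|o os IH] i j /=; first by rewrite mxE ler0n.
rewrite mxE sumr_ge0// => k _; rewrite mulr_ge0 ?sQ.1// mul_diag_mx !mxE.
by rewrite mulr_ge0 ?emission_ge0.
Qed.

(** Each entry is the conditional probability of the pattern given the preceding state, so
    [ergodic_sum_bounded] applies to this vector. *)
Lemma chain_mx_row01 os i :
  0 <= (chain_mx Q (map emission os) *m (const_mx 1 : 'cV_J)) i 0 <= 1.
Proof.
elim: os i => [|o os IH] i /=; first by rewrite mul1mx mxE ler01 lexx.
rewrite -!mulmxA mxE; apply/andP; split.
  rewrite sumr_ge0// => k _; rewrite mulr_ge0 ?sQ.1// mul_diag_mx mxE mulr_ge0//.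
    by rewrite mxE emission_ge0.
  by have /andP[] := IH k.
rewrite -[leRHS](sQ.2 i); apply: ler_sum => k _; rewrite ler_piMr ?sQ.1//.
rewrite mul_diag_mx mxE mulr_ile1 ?[(\row__ _) 0 k]mxE ?emission_ge0 ?emission_le1//.
  by have /andP[] := IH k.
by have /andP[] := IH k.
Qed.

Lemma pattern_prob_big os N : size os = N -> pattern_prob os =
  \sum_(th : N.-tuple 'I_J) markov_weight Q pi th *
     \prod_(n < N) emission (nth None os n) (tnth th n).
Proof.
move=> sz; rewrite /pattern_prob -(@markov_weight_sum _ _ _ _ N) ?size_map ?ipi.2.1 ?ipi.2.2//.
apply: eq_bigr => th _; congr (_ * _); apply: eq_bigr => n _.
by rewrite (nth_map None) ?sz.
Qed.

Lemma expect_pattern N os : size os = N ->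
  expect (fun x : N.-tuple int => pattern R os x) = (pattern_prob os)%:E.
Proof.
move=> sz; rewrite (pattern_prob_big sz).
rewrite -(@esum_markov _ _ _ _ _ _ (fun n j z => f j z * cell R (nth None os n) z)
  (fun n => emission (nth None os n))).
- apply: eq_esum => x _; rewrite (pattern_big _ _ sz) mulr_suml; congr (_%:E).
  by apply: eq_bigr => th _; rewrite -mulrA -big_split.
- exact: sQ.1.
- exact: ipi.1.
- by move=> n j z; rewrite mulr_ge0 ?cell_ge0 ?(fpmf _).1.
- by move=> n j; exact: emission_esum.
Qed.

Lemma pattern_prob_ge0 os : 0 <= pattern_prob os.
Proof.
rewrite (pattern_prob_big (erefl _)) sumr_ge0// => th _.
by rewrite mulr_ge0 ?markov_weight_ge0// prodr_ge0// => n _; exact: emission_ge0.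
Qed.

Lemma chain_mx_None m : chain_mx Q (map emission (nseq m None)) = Q ^+ m.
Proof. by rewrite map_nseq -(chain_mx1 Q m). Qed.

Lemma pattern_prob_Nonel m os : pattern_prob (nseq m None ++ os) = pattern_prob os.
Proof.
rewrite /pattern_prob map_cat chain_mx_cat chain_mx_None mulmxA.
by rewrite (invariant_exp ipi).
Qed.

Lemma pattern_prob_Noner m os : pattern_prob (os ++ nseq m None) = pattern_prob os.
Proof.
rewrite /pattern_prob map_cat chain_mx_cat chain_mx_None -!mulmxA.
by rewrite (stochastic_mul1 sQ).
Qed.

(** The summands are covariances of two occurrences [m] places apart. The bound is linear in
    [pattern_prob os] with one constant for all patterns, so it can later be summed over infinitely
    many patterns. *)
Lemma pattern_prob_repeat : exists2 C : R, 0 <= C &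
  forall os k,
  \sum_(m < k) (pattern_prob (os ++ nseq m None ++ os) - pattern_prob os ^+ 2)
    <= C * pattern_prob os.
Proof.
have [C C0 HC] := ergodic_sum_bounded sQ iQ ipi; exists C => // os k.
pose K := chain_mx Q (map emission os); pose v := K *m (const_mx 1 : 'cV_J).
pose rho := pi *m K.
have pv : (pi *m v) 0 0 = pattern_prob os by rewrite mulmxA.
have rho_sum : \sum_a rho 0 a = pattern_prob os.
  by rewrite [RHS]mxE; apply: eq_bigr => a _; rewrite [const_mx _ _ _]mxE mulr1.
(* [rho] is the joint mass of the pattern and its last state, and [v] the chance of a fresh
   occurrence after a given state. *)
have E m : pattern_prob (os ++ nseq m None ++ os) - pattern_prob os ^+ 2 =
    \sum_a rho 0 a * ((Q ^+ m *m v) a 0 - (pi *m v) 0 0).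
  under eq_bigr do rewrite mulrBr.
  rewrite sumrB -mulr_suml rho_sum pv -expr2; congr (_ - _).
  rewrite /pattern_prob !map_cat !chain_mx_cat chain_mx_None -!mulmxA [pi *m _]mulmxA.
  by rewrite mxE.
under eq_bigr do rewrite E.
rewrite exchange_big /= -rho_sum mulr_sumr; apply: ler_sum => a _.
rewrite -mulr_sumr mulrC ler_wpM2r//.
  rewrite mxE sumr_ge0// => i _; rewrite mulr_ge0 ?ipi.1//; exact: chain_mx_ge0.
by apply: le_trans (ler_norm _) _; apply: HC => i; exact: chain_mx_row01.
Qed.

Lemma expectD N (phi psi : N.-tuple int -> R) :
  (forall x, 0 <= phi x) -> (forall x, 0 <= psi x) ->
  expect (fun x => phi x + psi x) = (expect phi + expect psi)%E.
Proof.
move=> phi0 psi0; rewrite -esumD => [|x _|x _].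
- by apply: eq_esum => x _; rewrite -EFinD mulrDr.
- by rewrite lee_fin mulr_ge0 ?hmm_pmf_ge0.
- by rewrite lee_fin mulr_ge0 ?hmm_pmf_ge0.
Qed.

Lemma expectZ N (c : R) (phi : N.-tuple int -> R) :
  0 <= c -> (forall x, 0 <= phi x) ->
  expect (fun x => c * phi x) = (c%:E * expect phi)%E.
Proof.
move=> c0 phi0; rewrite -esumZl// => [|x].
  by apply: eq_esum => x _; rewrite -EFinM mulrCA.
by rewrite lee_fin mulr_ge0 ?hmm_pmf_ge0.
Qed.

Lemma expect_sum N n (phi : 'I_n -> N.-tuple int -> R) :
  (forall i x, 0 <= phi i x) ->
  expect (fun x => \sum_i phi i x) = (\sum_i expect (phi i))%E.
Proof.
move=> phi0; rewrite -esum_sum => [|x i _ _].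
  by apply: eq_esum => x _; rewrite sumEFin mulr_sumr.
by rewrite lee_fin mulr_ge0 ?hmm_pmf_ge0.
Qed.

Lemma le_expect N (phi psi : N.-tuple int -> R) :
  (forall x, phi x <= psi x) -> (expect phi <= expect psi)%E.
Proof.
by move=> pp; apply: le_esum => x _; rewrite lee_fin ler_wpM2l// hmm_pmf_ge0.
Qed.

Lemma expect_ge0 N (phi : N.-tuple int -> R) :
  (forall x, 0 <= phi x) -> (0 <= expect phi)%E.
Proof.
by move=> phi0; apply: esum_ge0 => x _; rewrite lee_fin mulr_ge0// hmm_pmf_ge0.
Qed.

(** Wildcards pad the window to length [N]; stationarity on the left and unit row sums on the right
    remove them from the probability. *)
Lemma expect_window N os s : (s + size os <= N)%N ->
  expect (fun x : N.-tuple int => pattern R os (drop s x)) = (pattern_prob os)%:E.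
Proof.
move=> sN; rewrite -(pattern_prob_Noner (N - (s + size os)) os) -(pattern_prob_Nonel s).
rewrite -(@expect_pattern N); last by rewrite !size_cat !size_nseq; lia.
by apply: eq_esum => x _; rewrite !pattern_cat !pattern_None mul1r mulr1 size_nseq.
Qed.

Lemma expect_window2 N os s m : (s + size os + m + size os <= N)%N ->
  expect (fun x : N.-tuple int =>
    pattern R os (drop s x) * pattern R os (drop (s + size os + m) x)) =
  (pattern_prob (os ++ nseq m None ++ os))%:E.
Proof.
move=> sN; rewrite -(@expect_window N _ s); last by rewrite !size_cat size_nseq; lia.
apply: eq_esum => x _; rewrite !pattern_cat pattern_None mul1r size_nseq !drop_drop.
by rewrite (_ : (s + size os + m = m + size os + s)%N)//; lia.
Qed.

Definition visits (os : seq (option int)) N (x : N.-tuple int) : R :=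
  \sum_(s < N - 2) pattern R os (drop s x).

Lemma visits_variance : exists2 C : R, 0 <= C & forall os N, size os = 3 ->
  (expect (fun x : N.-tuple int =>
     ((visits os x - (N - 2)%:R * pattern_prob os) ^+ 2)%R)
   <= ((N - 2)%:R * C * pattern_prob os)%:E)%E.
Proof.
(* For each window, [C] accounts for the disjoint earlier windows and 2 for the two overlapping
   ones; symmetry doubles this and the diagonal adds 1. *)
have [C C0 HC] := pattern_prob_repeat; exists (2 * (C + 2) + 1).
  by rewrite addr_ge0// mulr_ge0// addr_ge0.
move=> os N os3; set p := pattern_prob os; set n := (N - 2)%N.
have p0 : 0 <= p := pattern_prob_ge0 os.
pose w s (x : N.-tuple int) := pattern R os (drop s x).
have w0 s x : 0 <= w s x by exact: pattern_ge0.
have ww0 s t x : 0 <= w s x * w t x by rewrite mulr_ge0.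
have Ew s : (s < n)%N -> expect (w s) = p%:E.
  by move=> sn; apply: expect_window; rewrite os3; lia.
pose r s t := fine (expect (fun x => w s x * w t x)).
have Eww_le s t : (s < n)%N -> (expect (fun x => (w s x * w t x)%R) <= p%:E)%E.
  move=> sn; rewrite -(Ew s sn); apply: le_expect => x.
  by rewrite ler_piMr// pattern_le1.
have rE s t : (s < n)%N -> expect (fun x => w s x * w t x) = (r s t)%:E.
  move=> sn; rewrite fineK// ge0_fin_numE; last exact: expect_ge0.
  by rewrite (le_lt_trans (Eww_le _ t sn))// ltry.
have r_le s t : (s < n)%N -> r s t <= p.
  by move=> sn; rewrite -lee_fin -rE// Eww_le.
have rC s t : r s t = r t s.
  by congr fine; apply: eq_esum => x _; rewrite [w s x * _]mulrC.
have rs : \sum_(s < n) \sum_(t < n) r s t <=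
    n%:R ^+ 2 * p ^+ 2 + n%:R * (2 * (C * p + 2 * p) + p).
  apply: double_sum_le => //.
  - by move=> s; exact: r_le.
  - exact: sqr_ge0.
  have q0 : 0 <= p ^+ 2 by exact: sqr_ge0.
  have Cp : 0 <= C * p by rewrite mulr_ge0.
  (* A window of length three overlaps the two windows starting just before it, whose second moments
     are at most [p]. Starts 0 and 1 have fewer than two predecessors. *)
  move=> [|[|k]] kn; first by rewrite big_ord0 addr_ge0// mulr_ge0.
    by rewrite big_ord_recl big_ord0 addr0; have := @r_le 0%N 1%N (ltnW kn); lra.
  rewrite big_ord_recr big_ord_recr /=.
  have r1 := @r_le k k.+2 (ltnW (ltnW kn)); have r2 := @r_le k.+1 k.+2 (ltnW kn).
  suff : \sum_(s < k) (r s k.+2 - p ^+ 2) <= C * p by lra.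
  (* Reversal makes [m] the gap between the end of the earlier window and the start [k.+2] of the
     later one. *)
  rewrite (reindex_inj rev_ord_inj); apply: le_trans (HC os k); rewrite le_eqVlt.
  apply/orP; left; apply/eqP; apply: eq_bigr => m _ /=; congr (_ - _).
  rewrite /r (_ : k.+2 = (k - m.+1 + size os + m)%N).
    rewrite expect_window2//; have := ltn_ord m; lia.
  by have := ltn_ord m; lia.
have ES : expect (visits os (N := N)) = (n%:R * p)%:E.
  rewrite expect_sum; last by move=> s x; exact: w0.
  under eq_bigr do rewrite Ew//.
  by rewrite sumEFin sumr_const card_ord mulr_natl.
have ES2 : expect (fun x : N.-tuple int => visits os x ^+ 2) =
    (\sum_(s < n) \sum_(t < n) r s t)%:E.
  transitivity (expect (fun x => \sum_(s < n) \sum_(t < n) w s x * w t x)).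
    apply: eq_esum => x _; congr (_ * _)%:E; rewrite expr2 mulr_suml.
    by apply: eq_bigr => s _; rewrite mulr_sumr.
  rewrite expect_sum; last by move=> s x; rewrite sumr_ge0.
  rewrite -sumEFin; apply: eq_bigr => s _; rewrite expect_sum//.
  by rewrite -sumEFin; apply: eq_bigr => t _; rewrite rE.
have np0 : 0 <= n%:R * p by rewrite mulr_ge0.
have E1 : expect (fun _ : N.-tuple int => 1) = 1%:E.
  have : expect (fun x : N.-tuple int => pattern R (nseq N None) x) = 1%:E.
    rewrite expect_pattern ?size_nseq// -[nseq _ _]cats0 pattern_prob_Nonel.
    by rewrite /pattern_prob mulmx1 (pi_ones ipi) mxE eqxx.
  by move=> <-; apply: eq_esum => x _; rewrite pattern_None.
(* The cross term is moved to the left, so that only expectations of nonnegative functions occur. *)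
have key : (expect (fun x : N.-tuple int => ((visits os x - n%:R * p) ^+ 2)%R)
    + (2 * (n%:R * p) * (n%:R * p))%:E =
    (\sum_(s < n) \sum_(t < n) r s t + (n%:R * p) ^+ 2)%:E)%E.
  rewrite EFinM -ES -expectZ; last 2 first.
  - by rewrite mulr_ge0.
  - by move=> x; rewrite sumr_ge0// => s _; exact: w0.
  rewrite -expectD; last 2 first.
  - by move=> x; exact: sqr_ge0.
  - by move=> x; rewrite !mulr_ge0// sumr_ge0// => s _; exact: w0.
  rewrite EFinD -ES2 -[X in _ = (_ + X)%E]mule1 -E1 -expectZ ?sqr_ge0//.
  rewrite -expectD ?sqr_ge0//.
  - by apply: eq_esum => x _; congr (_ * _)%:E; ring.
  - by move=> x; exact: sqr_ge0.
  - by move=> _; rewrite mulr1 sqr_ge0.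
rewrite -(@leeD2rE _ (2 * (n%:R * p) * (n%:R * p))%:E)// key -EFinD lee_fin; lra.
Qed.

(** At each position the wildcard contributes 1 and all integers together contribute 1, whence the
    factor 2. *)
Lemma pattern_prob_esum N : exists2 K : R, 0 <= K &
  \esum_(u in [set: N.-tuple (option int)]) (pattern_prob u)%:E = K%:E.
Proof.
exists (\sum_(th : N.-tuple 'I_J) markov_weight Q pi th * \prod_(n < N) 2).
  by apply: sumr_ge0 => th _; rewrite mulr_ge0 ?markov_weight_ge0// prodr_ge0.
rewrite -(@esum_markov _ _ _ _ _ N (fun _ j o => emission o j) (fun _ _ => 2)).
- apply: eq_esum => u _; rewrite (pattern_prob_big (size_tuple u)); congr (_%:E).
  apply: eq_bigr => th _; congr (_ * _); apply: eq_bigr => i _.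
  by rewrite (tnth_nth None).
- exact: sQ.1.
- exact: ipi.1.
- by move=> _ j o; exact: emission_ge0.
- move=> _ j; rewrite esum_option => [|o]; last by rewrite lee_fin emission_ge0.
  by rewrite (fpmf j).2.
Qed.

Lemma visits_deviation : exists2 K : R, 0 <= K & forall N (e : R), (2 < N)%N -> 0 < e ->
  (hmm_prob Q pi f [set x : N.-tuple int | exists u : 3.-tuple (option int),
     (e <= `|visits u x / (N - 2)%:R - pattern_prob u|)%R]
   <= (K / ((N - 2)%:R * e ^+ 2))%:E)%E.
Proof.
have [C C0 HC] := visits_variance; have [K K0 HK] := pattern_prob_esum 3.
exists (C * K); first by rewrite mulr_ge0.
move=> N e N2 e0; set A := [set _ | _].
have n0 : 0 < (N - 2)%:R :> R by rewrite ltr0n subn_gt0.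
set n : R := (N - 2)%:R in n0 *.
(* [F u x] is at least 1 wherever the frequency of [u] is off by [e], so its sum over [u] dominates
   the indicator of the event: Chebyshev and the union bound at once. *)
pose F (u : 3.-tuple (option int)) (x : N.-tuple int) :=
  (n * e) ^- 2 * (visits u x - n * pattern_prob u) ^+ 2.
have F0 u x : 0 <= F u x by rewrite mulr_ge0 ?invr_ge0 ?sqr_ge0.
have pF0 u x : (0 <= (hmm_pmf Q pi f x * F u x)%:E)%E.
  by rewrite lee_fin mulr_ge0 ?hmm_pmf_ge0.
apply: (@le_trans _ _ (\esum_(x in [set: N.-tuple int])
    \esum_(u in [set: 3.-tuple (option int)]) (hmm_pmf Q pi f x * F u x)%:E)).
  rewrite /hmm_prob esum_mkcond; apply: le_esum => x _.
  case: ifPn => [|_]; last exact: esum_ge0.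
  rewrite inE => -[u eu]; rewrite (esumID [set u]) ?setTI//.
  rewrite esum_set1// -[leLHS]adde0 leeD ?esum_ge0// lee_fin ler_peMr ?hmm_pmf_ge0//.
  rewrite /F -exprVn -exprMn -real_normK ?num_real// expr_ge1 ?normr_ge0//.
  have -> : (n * e)^-1 * (visits u x - n * pattern_prob u) =
      e^-1 * (visits u x / n - pattern_prob u).
    by field; rewrite !gt_eqF.
  by rewrite normrM gtr0_norm ?invr_gt0// mulrC ler_pdivlMr// mul1r.
rewrite esum_esum// (reindex_esum (setT `*`` (fun=> setT)) _
    (fun p : 3.-tuple (option int) * N.-tuple int => (p.2, p.1))); last first.
  split => //= [[u x] [u' x'] _ _ [-> ->]//|[x u] _].
  by exists (u, x).
rewrite -(@esum_esum _ _ _ _ _ (fun (u : 3.-tuple (option int)) (x : N.-tuple int) =>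
  (hmm_pmf Q pi f x * F u x)%:E))//.
apply: (@le_trans _ _ (\esum_(u in [set: 3.-tuple (option int)])
    ((C / (n * e ^+ 2))%:E * (pattern_prob u)%:E)%E)).
  apply: le_esum => u _; rewrite -/(expect (F u)) expectZ ?invr_ge0 ?sqr_ge0//; last first.
    by move=> x; exact: sqr_ge0.
  apply: (@le_trans _ _ (((n * e) ^- 2)%:E * (n * C * pattern_prob u)%:E)%E).
    apply: lee_wpmul2l; first by rewrite lee_fin invr_ge0 sqr_ge0.
    exact: HC (size_tuple u).
  rewrite -EFinM lee_fin le_eqVlt; apply/orP; left; apply/eqP.
  by rewrite -/n; field; rewrite !gt_eqF.
rewrite esumZl ?HK.
- by rewrite -EFinM lee_fin mulrAC.
- by rewrite divr_ge0// mulr_ge0 ?sqr_ge0// ltW.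
- by move=> u; rewrite lee_fin pattern_prob_ge0.
Qed.

End Variance.

(** * Stability of rank-J decompositions *)

Section EntryNorm.
Variable R : realType.

Definition l1norm m n (A : 'M[R]_(m, n)) : R := \sum_i \sum_j `|A i j|.

Lemma l1norm_ge0 m n (A : 'M[R]_(m, n)) : 0 <= l1norm A.
Proof. by rewrite sumr_ge0// => i _; rewrite sumr_ge0. Qed.

Lemma le_l1norm m n (A : 'M[R]_(m, n)) i j : `|A i j| <= l1norm A.
Proof.
rewrite /l1norm (bigD1 i)//= (bigD1 j)//= -addrA lerDl addr_ge0 ?sumr_ge0// => k _.
by rewrite sumr_ge0.
Qed.

Lemma l1normD m n (A B : 'M[R]_(m, n)) : l1norm (A + B) <= l1norm A + l1norm B.
Proof.
rewrite -big_split; apply: ler_sum => i _ /=; rewrite -big_split.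
by apply: ler_sum => j _ /=; rewrite mxE ler_normD.
Qed.

Lemma l1normN m n (A : 'M[R]_(m, n)) : l1norm (- A) = l1norm A.
Proof. by apply: eq_bigr => i _; apply: eq_bigr => j _; rewrite mxE normrN. Qed.

Lemma l1normM m n p (A : 'M[R]_(m, n)) (B : 'M[R]_(n, p)) :
  l1norm (A *m B) <= l1norm A * l1norm B.
Proof.
rewrite /l1norm mulr_suml; apply: ler_sum => i _.
apply: (@le_trans _ _ (\sum_k \sum_j `|A i j| * `|B j k|)).
  apply: ler_sum => k _; rewrite mxE (le_trans (ler_norm_sum _ _ _))//.
  by apply: ler_sum => j _; rewrite normrM.
rewrite exchange_big mulr_suml; apply: ler_sum => j _ /=.
rewrite -mulr_sumr ler_wpM2l// [leRHS](bigD1 j)//= lerDl.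
by rewrite sumr_ge0// => k _; rewrite sumr_ge0.
Qed.

Lemma l1norm_eq0 m n (A : 'M[R]_(m, n)) : l1norm A <= 0 -> A = 0.
Proof.
move=> A0; apply/matrixP => i j; rewrite mxE; apply/eqP; rewrite -normr_le0.
exact: le_trans (le_l1norm A i j) A0.
Qed.

Lemma l1norm_le m n (A : 'M[R]_(m, n)) (e : R) :
  (forall i j, `|A i j| <= e) -> l1norm A <= (m * n)%:R * e.
Proof.
move=> Ae; apply: (@le_trans _ _ (\sum_(i < m) \sum_(j < n) e)).
  by apply: ler_sum => i _; apply: ler_sum.
by rewrite !sumr_const !card_ord -mulrnA mulr_natl mulnC.
Qed.

Lemma row_free_ker m n (A : 'M[R]_(m, n)) :
  (forall w : 'rV_m, w *m A = 0 -> w = 0) -> row_free A.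
Proof.
move=> inj; rewrite -kermx_eq0; apply/eqP/row_matrixP => i.
by rewrite row0; apply: inj; rewrite -row_mul mulmx_ker row0.
Qed.

(** A row vector in the kernel satisfies [w = - (w *m E)], so its norm is at most half of itself. *)
Lemma unitmx_near1 n (E : 'M[R]_n) : l1norm E <= 2^-1 -> 1%:M + E \in unitmx.
Proof.
move=> E2; rewrite -row_free_unit; apply: row_free_ker => w.
rewrite mulmxDr mulmx1 => /eqP; rewrite addr_eq0 => /eqP wE.
apply: l1norm_eq0.
have : l1norm w <= l1norm w * l1norm E by rewrite {1}wE l1normN l1normM.
have := l1norm_ge0 w; nra.
Qed.

End EntryNorm.

(** Points are added one at a time: fewer than [J] rows are annihilated by some nonzero [c], and
    independence supplies a point where the combination with coefficients [c] does not vanish. *)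
Lemma lin_indep_points (R : realType) (J : nat) (f : 'I_J -> int -> R) :
  lin_indep f -> exists p : 'I_J -> int, (\matrix_(k, j) f j (p k)) \in unitmx.
Proof.
move=> lif.
suff [p pP] : exists p : 'I_J -> int, row_free (\matrix_(k < J, j < J) f j (p k)).
  by exists p; rewrite -row_free_unit.
suff : forall m, (m <= J)%N ->
    exists p : 'I_m -> int, row_free (\matrix_(k < m, j < J) f j (p k)) by exact.
elim=> [|m IH] mJ.
  exists (fun=> 0); apply: row_free_ker => w _; exact: thinmx0.
have [p] := IH (ltnW mJ); set B := \matrix_(_, _) _ => Bfree.
have [c Bc c0] : exists2 c : 'cV[R]_J, B *m c = 0 & c != 0.
  apply: contrapT => nex; have : row_free B^T.
    apply: row_free_ker => w wB; apply: contrapT => /eqP w0; apply: nex.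
    exists w^T; last by rewrite -trmx0 (inj_eq trmx_inj).
    by apply: trmx_inj; rewrite trmx_mul trmxK trmx0.
  by move: Bfree; rewrite /row_free mxrank_tr => /eqP -> /eqP Jm; rewrite Jm ltnn in mJ.
have [z fz] : exists z, \sum_j c j 0 * f j z != 0.
  apply: contrapT => /forallNP nz; move/eqP: c0; apply; apply/colP => j.
  rewrite mxE; apply: (lif (fun j => c j 0)) => z.
  by apply/eqP; apply: contrapT => /negP; exact: nz.
exists (fun i => if unlift ord0 i is Some k then p k else z).
apply: row_free_ker => w wM.
(* Applying the relation between rows to [c] kills the old rows and isolates the coefficient of the
   new point, stored at [ord0]. *)
have E : \sum_(i < m.+1) w 0 i * (\sum_j c j 0 * f j (if unlift ord0 i is Some k then p k else z)) = 0.
  have := congr1 (fun A => (A *m c) 0 0) wM; rewrite -mulmxA mul0mx [RHS]mxE mxE => wMc.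
  rewrite -[RHS]wMc; apply: eq_bigr => i _; rewrite mxE; congr (_ * _).
  by apply: eq_bigr => j _; rewrite mxE mulrC.
have w0 : w 0 ord0 = 0.
  move: E; rewrite big_ord_recl unlift_none [X in _ + X]big1 => [|i _].
    by rewrite addr0 => /eqP; rewrite mulf_eq0 (negPf fz) orbF => /eqP.
  have := congr1 (fun A : 'cV_m => A i 0) Bc; rewrite mxE [RHS]mxE => Bci.
  rewrite liftK -[RHS](mulr0 (w 0 (lift ord0 i))) -[in RHS]Bci; congr (_ * _).
  by apply: eq_bigr => j _; rewrite mxE mulrC.
have wl : \row_i w 0 (lift ord0 i) = 0 :> 'rV_m.
  apply: (row_free_injr Bfree); rewrite /= mul0mx -[RHS]wM; apply/rowP => j.
  rewrite !mxE big_ord_recl w0 mul0r add0r; apply: eq_bigr => i _.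
  by rewrite !mxE liftK.
apply/rowP => i; rewrite [RHS]mxE; case: (unliftP ord0 i) => [k|] -> //.
by have /rowP/(_ k) := wl; rewrite !mxE.
Qed.

Section Stability.
Variables (R : realType) (J : nat) (a b c : 'I_J -> int -> R).
Hypotheses (lia : lin_indep a) (lic : lin_indep c) (b1 : forall j y, `|b j y| <= 1).

(* With [U = A^-1 A'] and [V = C' C^-1], the two hypotheses give
   [U V = 1 + O(d)] and [U diag(b'(y)) V = diag(b(y)) + O(d)], so that
   [U diag(b'(y)) - diag(b(y)) U = O(d)], whose entries are
   [U j i * (b' i y - b j y)]; and each row of U has an entry bounded below. *)
Lemma decomposition_stable : exists C : R, exists2 d0 : R, 0 < d0 &
  forall (d : R) (a' b' c' : 'I_J -> int -> R), 0 <= d <= d0 ->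
    (forall j x, `|a' j x| <= 1) -> (forall j x, `|c' j x| <= 1) ->
    (forall x y z, `|\sum_j a' j x * b' j y * c' j z
                     - \sum_j a j x * b j y * c j z| <= d) ->
    (forall x z, `|\sum_j a' j x * c' j z - \sum_j a j x * c j z| <= d) ->
  forall j, exists i, forall y, `|b' i y - b j y| <= C * d.
Proof.
have [p Au] := lin_indep_points lia; have [q Cu] := lin_indep_points lic.
set A := \matrix_(_, _) _ in Au; rewrite -unitmx_tr in Cu; set Cm := _^T in Cu.
pose al := l1norm (invmx A); pose ga := l1norm (invmx Cm).
pose s : R := (J * J)%:R.
have al0 : 0 <= al := l1norm_ge0 _; have ga0 : 0 <= ga := l1norm_ge0 _.
have s0 : 0 <= s by rewrite ler0n.
(* If a row of [U] had all entries below [t], the matching diagonal entry of [U *m V] would be at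
   most 1/4, while it is at least 1/2. *)
pose t : R := (4 * (s * ga + 1))^-1.
have t0 : 0 < t by rewrite invr_gt0 mulr_gt0// ltr_wpDl// mulr_ge0.
pose k := al * ga * s; have k0 : 0 <= k by rewrite !mulr_ge0.
(* [k * d] bounds both perturbations [E0] and [E1]; the choice of [d0] makes it at most 1/2. *)
exists (2 * ((1 + s) * k) * (al * s) / t), (2 * (k + 1))^-1.
  by rewrite invr_gt0 mulr_gt0// ltr_wpDl.
move=> d a' b' c' /andP[d0 dd0] a'1 c'1 H3 H2.
have kd : k * d <= 2^-1.
  apply: (@le_trans _ _ (k * (2 * (k + 1))^-1)); first by rewrite ler_wpM2l.
  rewrite invfM mulrCA ger_pMr ?invr_gt0//.
  by rewrite ler_pdivrMr ?ltr_wpDl// mul1r lerDl.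
pose A' := \matrix_(k < J, j < J) a' j (p k).
pose C' := \matrix_(j < J, k < J) c' j (q k).
pose D y := diag_mx (\row_j b j y); pose D' y := diag_mx (\row_j b' j y).
pose U := invmx A *m A'; pose V := C' *m invmx Cm.
have nU : l1norm U <= al * s.
  rewrite (le_trans (l1normM _ _))// ler_wpM2l// -[leRHS]mulr1 l1norm_le// => i j.
  by rewrite mxE.
have nV : l1norm V <= s * ga.
  rewrite (le_trans (l1normM _ _))// ler_wpM2r// -[leRHS]mulr1 l1norm_le// => i j.
  by rewrite mxE.
have near (M M' : 'M[R]_J) : (forall i j, `|M' i j - M i j| <= d) ->
    l1norm (invmx A *m (M' - M) *m invmx Cm) <= k * d.
  move=> MM; rewrite (le_trans (l1normM _ _))//.
  have le1 : l1norm (invmx A *m (M' - M)) <= al * (s * d).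
    rewrite (le_trans (l1normM _ _))// ler_wpM2l// l1norm_le// => i j.
    by rewrite !mxE.
  rewrite (le_trans (ler_wpM2r ga0 le1))//; rewrite /k; lra.
pose E0 := U *m V - 1%:M.
have nE0 : l1norm E0 <= k * d.
  rewrite (_ : E0 = invmx A *m (A' *m C' - A *m Cm) *m invmx Cm).
    apply: near => i j; rewrite !mxE.
    have := H2 (p i) (q j); congr (`|_ - _| <= _); apply: eq_bigr => l _; by rewrite !mxE.
  by rewrite mulmxBr mulmxBl mulmxA mulKmx// mulmxV// /E0 /U /V !mulmxA.
pose E1 y := U *m D' y *m V - D y.
have nE1 y : l1norm (E1 y) <= k * d.
  rewrite (_ : E1 y = invmx A *m (A' *m D' y *m C' - A *m D y *m Cm) *m invmx Cm).
    apply: near => i j; rewrite !mxE.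
    have := H3 (p i) y (q j); congr (`|_ - _| <= _); apply: eq_bigr => l _;
    by rewrite mul_mx_diag !mxE.
  by rewrite mulmxBr mulmxBl !mulmxA mulVmx// mul1mx mulmxK// /E1 /U /V !mulmxA.
have UV : U *m V = 1%:M + E0 by rewrite /E0 addrC subrK.
have UVu : U *m V \in unitmx.
  by rewrite UV unitmx_near1// (le_trans nE0).
have Uu : U \in unitmx by move: UVu; rewrite unitmx_mul => /andP[].
move=> j; have [i tU] : exists i, t <= `|U j i|.
  apply: contrapT => /forallNP nt.
  have : 1 - k * d <= `|(U *m V) j j|.
    rewrite UV mxE [X in `|X + _|]mxE eqxx mulr1n; have := le_l1norm E0 j j.
    by have := lerB_normD 1 (E0 j j); rewrite normr1; lra.
  apply/negP; rewrite -ltNge; apply: (@le_lt_trans _ _ (t * (s * ga))).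
    rewrite mxE (le_trans (ler_norm_sum _ _ _))//.
    apply: (@le_trans _ _ (t * l1norm V)); last by rewrite ler_wpM2l// ltW.
    rewrite /l1norm mulr_sumr; apply: ler_sum => i _; rewrite normrM ler_pM//.
      by rewrite ltW// ltNge; apply/negP/nt.
    by rewrite (bigD1 j)//= lerDl sumr_ge0.
  have : t * (s * ga) <= 4^-1.
    rewrite /t invfM -mulrA ger_pMr ?invr_gt0// mulrC ler_pdivrMr ?mul1r ?lerDl//.
    by rewrite ltr_wpDl// mulr_ge0.
  lra.
exists i => y.
pose X := U *m D' y - D y *m U; pose W := X *m invmx U.
have XV : X *m V = E1 y - D y *m E0.
  rewrite mulmxBl -[D y *m U *m V]mulmxA UV mulmxDr mulmx1 /E1.
  by rewrite opprD addrA.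
have nD : l1norm (D y) <= s.
  rewrite -[leRHS]mulr1 l1norm_le// => l m; rewrite !mxE.
  by case: eqP => _; rewrite ?mulr1n// mulr0n normr0.
have nXV : l1norm (X *m V) <= (1 + s) * (k * d).
  rewrite XV (le_trans (l1normD _ _))// l1normN mulrDl mul1r lerD//.
  rewrite (le_trans (l1normM _ _))// ler_pM// ?l1norm_ge0//.
(* [X *m V] is [W *m (1%:M + E0)]; since [E0] has norm at most 1/2, its term is absorbed at the cost
   of a factor 2. *)
have nW : l1norm W <= 2 * ((1 + s) * (k * d)).
  have WE : W = X *m V - W *m E0.
    by rewrite -[X in X *m V](mulmxKV Uu) -/W -mulmxA UV mulmxDr mulmx1 addrK.
  have : l1norm W <= l1norm (X *m V) + l1norm W * l1norm E0.
    by rewrite {1}WE (le_trans (l1normD _ _))// l1normN lerD// l1normM.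
  have := l1norm_ge0 W; have := l1norm_ge0 E0; nra.
have nX : l1norm X <= 2 * ((1 + s) * (k * d)) * (al * s).
  rewrite -[X](mulmxKV Uu) (le_trans (l1normM _ _))// ler_pM// ?l1norm_ge0//.
have XE (M : 'M[R]_J) : (M *m D' y - D y *m M) j i = M j i * (b' i y - b j y).
  by rewrite mul_mx_diag mul_diag_mx !mxE; ring.
have := le_trans (le_l1norm X j i) nX; rewrite XE normrM => Xji.
have tX := le_trans (ler_wpM2r (normr_ge0 (b' i y - b j y)) tU) Xji.
rewrite mulrAC ler_pdivlMr// mulrC (le_trans tX)// le_eqVlt; apply/orP; left.
by apply/eqP; ring.
Qed.

End Stability.

(** * Labelling by lexicographic order *)

(** Induction from the top gives [s i <= i], from the bottom [i <= s i]. This identifies the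
    matching between two sorted families. *)
Lemma strictly_increasing_id (J : nat) (s : 'I_J -> 'I_J) :
  (forall i j : 'I_J, (i < j)%N -> (s i < s j)%N) -> s =1 id.
Proof.
move=> smono i; apply: val_inj; apply/eqP; rewrite eqn_leq; apply/andP; split.
  suff H n : forall i : 'I_J, (J - i <= n)%N -> (s i <= i)%N by exact: (H (J - i)%N).
  elim: n => [|n IH] {}i; first by have := ltn_ord i; lia.
  have [iJ|iJ] := ltnP i.+1 J; last by have := ltn_ord (s i); lia.
  move=> Jn; have /= := IH (Ordinal iJ); have /= := smono i (Ordinal iJ) (ltnSn i).
  lia.
suff H n : forall i : 'I_J, (i <= n)%N -> (i <= s i)%N by exact: (H i).
elim: n => [|n IH] {}i; first by lia.
case: i => [[|i] iJ] //= le_in.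
have /= := IH (Ordinal (ltnW iJ)); have /= := smono (Ordinal (ltnW iJ)) (Ordinal iJ) (ltnSn i).
lia.
Qed.

(** An index is ranked by the number of indices below it; totality makes the rank injective, and
    [tau] is its inverse. *)
Lemma sorting_perm (J : nat) (lt : 'I_J -> 'I_J -> Prop) :
  (forall i, ~ lt i i) -> (forall i j k, lt i j -> lt j k -> lt i k) ->
  (forall i j, i != j -> lt i j \/ lt j i) ->
  exists tau : {perm 'I_J}, forall i j : 'I_J, (i < j)%N -> lt (tau i) (tau j).
Proof.
move=> irr tr tot.
pose below j := [set i | `[< lt i j >]]%SET.
have below_lt i j : lt i j -> (#|below i| < #|below j|)%N.
  move=> ij; apply: proper_card; apply/fintype.properP; split.
    by apply/fintype.subsetP => k; rewrite !finset.inE => /asboolP ki; apply/asboolP; exact: tr _ _ _ ki ij.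
  by exists i; rewrite !finset.inE; [exact/asboolP|apply/asboolP/irr].
have below_J j : (#|below j| < J)%N.
  rewrite -[X in (_ < X)%N](card_ord J) -cardsT; apply: proper_card.
  by apply/fintype.properP; split; [exact: finset.subsetT|exists j; rewrite !finset.inE//; apply/asboolP/irr].
pose rk j := Ordinal (below_J j).
have rk_inj : injective rk.
  move=> i j /(congr1 val)/= ij; apply/eqP; apply: contrapT => /negP/tot[|] /below_lt.
    by rewrite ij ltnn.
  by rewrite ij ltnn.
exists ((perm rk_inj)^-1)%g => i j ij.
set ti := _ i; set tj := _ j.
have ti_i : rk ti = i by rewrite /ti -(permE rk_inj) permKV.
have tj_j : rk tj = j by rewrite /tj -(permE rk_inj) permKV.
have /tot[//|] : ti != tj by apply/eqP => tij; move: ij; rewrite -ti_i -tj_j tij ltnn.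
by move=> /below_lt; rewrite -[#|below tj|]/(rk tj : nat) tj_j -[#|below ti|]/(rk ti : nat) ti_i; lia.
Qed.

Section Lexicographic.
Variable R : realType.
Implicit Types g h k : int -> R.

(* Lexicographic order along the enumeration [pickle] of the integers, where
   values differing by at most [e] count as equal. *)
Definition lex_lt (e : R) g h := exists z : int,
  (forall l : int, (pickle l < pickle z)%N -> `|g l - h l| <= e) /\ g z + e < h z.

Lemma lex_lt_irr g : ~ lex_lt 0 g g.
Proof. by case=> z [_]; rewrite addr0 ltxx. Qed.

Lemma lex_lt0P g h : lex_lt 0 g h <-> exists z : int,
  (forall l : int, (pickle l < pickle z)%N -> g l = h l) /\ g z < h z.
Proof.
split=> -[z [zl zgh]]; exists z; split.
- by move=> l /zl; rewrite normr_le0 subr_eq0 => /eqP.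
- by rewrite addr0 in zgh.
- by move=> l /zl ->; rewrite subrr normr0.
- by rewrite addr0.
Qed.

Lemma lex_lt_trans g h k : lex_lt 0 g h -> lex_lt 0 h k -> lex_lt 0 g k.
Proof.
move=> /lex_lt0P[z [zl zgh]] /lex_lt0P[z' [z'l z'hk]]; apply/lex_lt0P.
have [zz'|zz'|zz'] := ltngtP (pickle z) (pickle z').
- exists z; split; last by rewrite -z'l.
  by move=> l lz; rewrite zl// z'l// (ltn_trans lz).
- exists z'; split; last by rewrite zl.
  by move=> l lz; rewrite zl ?z'l// (ltn_trans lz).
- exists z; split; first by move=> l lz; rewrite zl// z'l// -zz'.
  move/(pcan_inj pickleK): zz' => zz'; subst z'; exact: lt_trans zgh _.
Qed.

Lemma lex_lt_total g h : g <> h -> lex_lt 0 g h \/ lex_lt 0 h g.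
Proof.
move=> gh; pose P n := `[< exists2 z : int, pickle z = n & g z != h z >].
have exP : exists n, P n.
  apply: contrapT => nP; apply: gh; apply/funext => z.
  apply/eqP; apply: contrapT => /negP zgh; apply: nP.
  by exists (pickle z); apply/asboolP; exists z.
case: (ex_minnP exP) => n /asboolP[z zn zgh] nmin.
have zl l : (pickle l < pickle z)%N -> g l = h l.
  move=> lz; apply/eqP; apply: contrapT => /negP lgh.
  have : P (pickle l) by apply/asboolP; exists l.
  by move/nmin; rewrite -zn leqNgt lz.
have [gz|hz|/eqP] := ltgtP (g z) (h z).
- by left; apply/lex_lt0P; exists z.
- by right; apply/lex_lt0P; exists z; split => // l /zl.
- by rewrite (negPf zgh).
Qed.

(** Let [z] be the first disagreement. Before [z] the perturbed values differ by at most
    [2 * d <= e], so no strict step occurs there; at [z] they stay more than [e] apart in the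
    original direction, so a reversed comparison can neither be decided at [z] nor pass beyond
    it. *)
Lemma lex_lt_stable g h : lex_lt 0 g h -> exists2 gap : R, 0 < gap &
  forall d e : R, 0 <= d -> 2 * d <= e -> e < gap ->
  lex_lt e g h /\ forall g' h', (forall z, `|g' z - g z| <= d) ->
    (forall z, `|h' z - h z| <= d) -> ~ lex_lt e h' g' /\ g' <> h'.
Proof.
move=> /lex_lt0P[z [zl zgh]]; exists ((h z - g z) / 2); first by rewrite divr_gt0 ?subr_gt0.
move=> d e d0 de egap; split.
  exists z; split=> [l /zl ->|]; last by lra.
  rewrite subrr normr0; lra.
move=> g' h' g'd h'd.
have := g'd z; have := h'd z; rewrite !ler_norml => /andP[h1 h2] /andP[g1 g2].
split=> [[z' [z'l z'gh]]|gh']; last by rewrite gh' in g1 g2; lra.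
have [zz'|zz'|/(pcan_inj pickleK) zz'] := ltngtP (pickle z) (pickle z').
- by have := z'l z zz'; rewrite ler_norml => /andP[]; lra.
- have := g'd z'; have := h'd z'; rewrite -zl// !ler_norml => /andP[h3 h4] /andP[g3 g4].
  by lra.
- by rewrite -zz' in z'gh; lra.
Qed.

End Lexicographic.

(** * The estimator *)

Section Decomposition.
Variables (R : realType) (J : nat) (Q : 'M[R]_J) (pi : 'rV[R]_J) (f : 'I_J -> int -> R).
Hypotheses (HA2 : assumption_A2' Q pi) (HA3 : assumption_A3 f).

(* [past j x] is P(X_1 = x, theta_2 = j) and [future j z] is P(X_3 = z | theta_2 = j). *)
Definition past (j : 'I_J) (x : int) : R := \sum_i pi 0 i * f i x * Q i j.
Definition future (j : 'I_J) (z : int) : R := \sum_k Q j k * f k z.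

Let f_ge0 j z : 0 <= f j z. Proof. exact: (HA3.1 j).1. Qed.
Let f_le1 j z : f j z <= 1. Proof. exact: pmf_le1 (HA3.1) _ _. Qed.

Lemma past_le1 j x : `|past j x| <= 1.
Proof.
case: HA2 => sQ _ _ _ ipi.
rewrite ger0_norm; last first.
  by apply: sumr_ge0 => i _; rewrite !mulr_ge0 ?ipi.1 ?sQ.1.
rewrite -ipi.2.1; apply: ler_sum => i _; rewrite -mulrA ler_piMr ?ipi.1//.
rewrite mulr_ile1 ?sQ.1// -(sQ.2 i) (bigD1 j)//= lerDl sumr_ge0// => k _.
exact: sQ.1.
Qed.

Lemma future_le1 j z : `|future j z| <= 1.
Proof.
case: HA2 => sQ _ _ _ ipi.
rewrite ger0_norm; last by apply: sumr_ge0 => i _; rewrite mulr_ge0 ?sQ.1.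
by rewrite -(sQ.2 j); apply: ler_sum => i _; rewrite ler_piMr ?sQ.1.
Qed.

Let Q_unit : Q \in unitmx.
Proof. by case: HA2 => _ rQ _ _ _; rewrite -row_full_unit /row_full rQ. Qed.

(** The combination with coefficients [w] equals the sum of [pi 0 i * (Q *m w) i 0 * f i x];
    independence of [f], positivity of [pi] and invertibility of [Q] undo it in turn. *)
Lemma past_lin_indep : lin_indep past.
Proof.
case: HA2 => sQ _ iQ _ ipi w wpast.
pose v : 'cV[R]_J := \col_j w j.
suff Qv : Q *m v = 0.
  move=> j; have := mulKmx Q_unit v; rewrite Qv mulmx0 => /colP/(_ j).
  by rewrite !mxE.
apply/colP => i; rewrite [RHS]mxE.
have : pi 0 i * (Q *m v) i 0 = 0.
  apply: (HA3.2 (fun i => pi 0 i * (Q *m v) i 0)) => x; rewrite -[RHS](wpast x).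
  under [RHS]eq_bigr do rewrite mulr_sumr.
  rewrite exchange_big; apply: eq_bigr => k _ /=; rewrite mxE mulr_sumr mulr_suml.
  by apply: eq_bigr => l _; rewrite mxE; ring.
by move/eqP; rewrite mulf_eq0 (gt_eqF (invariant_gt0 sQ iQ ipi i)) => /eqP.
Qed.

Lemma future_lin_indep : lin_indep future.
Proof.
move=> w wfuture; pose v : 'rV[R]_J := \row_j w j.
suff vQ : v *m Q = 0.
  move=> j; have := mulmxK Q_unit v; rewrite vQ mul0mx => /rowP/(_ j).
  by rewrite !mxE.
apply/rowP => k; rewrite [RHS]mxE; apply: (HA3.2 (fun k => (v *m Q) 0 k)) => z.
rewrite -[RHS](wfuture z); under [RHS]eq_bigr do rewrite mulr_sumr.
rewrite exchange_big; apply: eq_bigr => l _ /=; rewrite mxE mulr_suml.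
by apply: eq_bigr => m _; rewrite mxE; ring.
Qed.

(** Past, present and future are independent given the middle state; [o = None] yields the law of
    the outer pair. *)
Lemma pattern_prob3 x o z :
  pattern_prob Q pi f [:: Some x; o; Some z] =
  \sum_j past j x * emission f o j * future j z.
Proof.
case: HA2 => sQ _ _ _ ipi; rewrite /pattern_prob /= mulmx1 !mulmxA ipi.2.2.
rewrite -!mulmxA mulmxA mulmxA mxE; apply: eq_bigr => j _.
rewrite mul_diag_mx !mxE; rewrite mulrA; congr (_ * _ * _).
  by apply: eq_bigr => i _; rewrite mul_mx_diag !mxE.
by apply: eq_bigr => i _; rewrite mul_diag_mx !mxE mulr1.
Qed.

Lemma lex_sorting_perm : exists tau : {perm 'I_J},
  forall i j : 'I_J, (i < j)%N -> lex_lt 0 (f (tau i)) (f (tau j)).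
Proof.
apply: (@sorting_perm _ (fun i j => lex_lt 0 (f i) (f j))).
- by move=> i; exact: lex_lt_irr.
- by move=> i j k; exact: lex_lt_trans.
move=> i j ij; apply: lex_lt_total => fij.
(* Two equal densities would be a linear dependence, with coefficients 1 at [i] and -1 at [j]. *)
have /HA3.2/(_ i) : forall z, \sum_k ((k == i)%:R - (k == j)%:R) * f k z = 0.
  move=> z; under eq_bigr do rewrite mulrBl.
  rewrite sumrB (bigD1 i)//= (bigD1 j (P := xpredT))//= !eqxx !mul1r fij.
  rewrite !big1 ?subrr// => k /negPf ->; exact: mul0r.
by move/eqP; rewrite eqxx (negPf ij) subr0 oner_eq0.
Qed.

End Decomposition.

Section Estimator.
Variables (R : realType) (J : nat).

(* [b] is the middle factor of a tensor within [e] of the empirical frequencies of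
   (X_n, X_n+1, X_n+2) and, through the wildcard [None], of (X_n, X_n+2); its
   components are sorted, up to [eta]. *)
Definition fits (e eta : R) N (x : N.-tuple int) (b : 'I_J -> int -> R) : Prop :=
  (exists a c : 'I_J -> int -> R,
    [/\ forall j y, `|a j y| <= 1, forall j y, `|c j y| <= 1 &
     forall y o z, `|\sum_j a j y * emission b o j * c j z -
       visits R [:: Some y; o; Some z] x / (N - 2)%:R| <= e]) /\
  forall i j : 'I_J, (i < j)%N -> lex_lt eta (b i) (b j).

Definition fit (e eta : R) N (x : N.-tuple int) : 'I_J -> int -> R :=
  if pselect (exists b, fits e eta x b) is left b then projT1 (cid b) else fun _ _ => 0.

Lemma fitP e eta N (x : N.-tuple int) b : fits e eta x b -> fits e eta x (fit e eta x).
Proof.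
by rewrite /fit; case: pselect => [exb _|nb bx]; [case: cid|case: nb; exists b].
Qed.

(** The deterministic half: when all frequencies are [e]-accurate, the sorted true densities fit, so
    the selected fit and the truth give tensors [2 * e] apart. Stability matches their components
    and sorting pins down the matching. *)
Lemma fit_close (Q : 'M[R]_J) (pi : 'rV[R]_J) (f : 'I_J -> int -> R) (tau : {perm 'I_J}) :
  assumption_A2' Q pi -> assumption_A3 f ->
  (forall i j : 'I_J, (i < j)%N -> lex_lt 0 (f (tau i)) (f (tau j))) ->
  exists C : R, exists2 r : R, 0 < r & forall (e eta : R) N (x : N.-tuple int),
    0 <= e -> C * e <= eta -> e < r -> eta < r ->
    (forall u : 3.-tuple (option int),
       `|visits R u x / (N - 2)%:R - pattern_prob Q pi f u| <= e) ->
    forall i z, `|fit e eta x i z - f (tau i) z| <= C * e.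
Proof.
move=> A2 A3 tau_lex.
have fb j y : `|f j y| <= 1.
  by rewrite ger0_norm ?(A3.1 j).1//; exact: pmf_le1 A3.1 _ _.
have [C [d0 d00 HC]] :=
  decomposition_stable (past_lin_indep A2 A3) (future_lin_indep A2 A3) fb.
have [g g0 Hg] : exists2 g : R, 0 < g & forall i j : 'I_J, (i < j)%N ->
    forall d e : R, 0 <= d -> 2 * d <= e -> e < g ->
    lex_lt e (f (tau i)) (f (tau j)) /\ forall g' h', (forall z, `|g' z - f (tau i) z| <= d) ->
    (forall z, `|h' z - f (tau j) z| <= d) -> ~ lex_lt e h' g' /\ g' <> h'.
  have H (p : 'I_J * 'I_J) : exists2 g : R, 0 < g & (p.1 < p.2)%N ->
    forall d e : R, 0 <= d -> 2 * d <= e -> e < g ->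
    lex_lt e (f (tau p.1)) (f (tau p.2)) /\ forall g' h', (forall z, `|g' z - f (tau p.1) z| <= d) ->
    (forall z, `|h' z - f (tau p.2) z| <= d) -> ~ lex_lt e h' g' /\ g' <> h'.
    have [/tau_lex/lex_lt_stable[g g0 gP]|_] := ltnP p.1 p.2; first by exists g.
    by exists 1.
  pose gap p := sval (cid2 (H p)).
  have gap0 p : 0 < gap p by rewrite /gap; case: cid2.
  (* One gap for all pairs; pairs out of order impose nothing and received the dummy gap 1. *)
  exists (\big[Num.min/1]_p gap p).
    by elim/big_ind: _ => // x y x0 y0; rewrite lt_min x0.
  move=> i j ij d e d_ge0 de eg.
  have egap : e < gap (i, j) by apply: lt_le_trans eg _; exact: bigmin_le_cond.
  by move: egap; rewrite /gap; case: cid2 => /= g _ gP egap; exact: gP.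
(* Components agree up to [2 * |C| * e] and the slack must be twice that, hence 4; [d0] is halved
   because the tensors are [2 * e] apart. *)
exists (4 * `|C|); exists (Num.min (d0 / 2) g); first by rewrite lt_min divr_gt0.
move=> e eta N x e0 Ce; rewrite !lt_min => /andP[ed0 _] /andP[_ eta_g] close i0 z0.
have C0 : 0 <= `|C| by [].
have D0 : 0 <= 2 * `|C| * e by rewrite !mulr_ge0.
have D2 : 2 * (2 * `|C| * e) <= eta by lra.
have sorted (i j : 'I_J) (ij : (i < j)%N) := Hg i j ij _ _ D0 D2 eta_g.
have freq y o z : `|visits R [:: Some y; o; Some z] x / (N - 2)%:R -
     \sum_j past Q pi f j y * emission f o j * future Q f j z| <= e.
  by rewrite -(pattern_prob3 f A2); exact: close [tuple Some y; o; Some z].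
have : fits e eta x (fun j => f (tau j)).
  split; last by move=> i j ij; have [] := sorted i j ij.
  exists (fun j => past Q pi f (tau j)), (fun j => future Q f (tau j)); split.
  - by move=> j y; exact: (past_le1 A2 A3).
  - by move=> j y; exact: (future_le1 A2 A3).
  move=> y o z; rewrite distrC; have := freq y o z.
  by rewrite (reindex_inj (@perm_inj _ tau)) /=; case: o.
move=> /fitP; set b := fit e eta x => -[[a [c [a1 c1 abc]]] b_sorted].
have de0 : 0 <= 2 * e <= d0 by apply/andP; split; lra.
have abc2 y o z : `|\sum_j a j y * emission b o j * c j z -
     \sum_j past Q pi f j y * emission f o j * future Q f j z| <= 2 * e.
  have := abc y o z; have := freq y o z.
  rewrite !ler_norml => /andP[h1 h2] /andP[h3 h4]; apply/andP; split; lra.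
have abc3 y z : `|\sum_j a j y * c j z - \sum_j past Q pi f j y * future Q f j z| <= 2 * e.
  have := abc2 y None z; congr (`|_ - _| <= _);
  by apply: eq_bigr => j _; rewrite /= mulr1.
have /choice[s sP] := HC _ a b c de0 a1 c1 (fun y o z => abc2 y (Some o) z) abc3.
have sD j y : `|b (s j) y - f j y| <= 2 * `|C| * e.
  by apply: le_trans (sP j y) _; rewrite mulrA [C * 2]mulrC ler_wpM2r// ler_wpM2l// ler_norm.
(* Both families are sorted and stability excludes reversals and coincidences, so [s \o tau] is
   increasing. *)
have s_id : s \o tau =1 id.
  apply: strictly_increasing_id => i j ij /=.
  have [_ /(_ _ _ (sD (tau i)) (sD (tau j)))[nlt neq]] := sorted i j ij.
  have [//|/b_sorted//|/val_inj E] := ltngtP (s (tau i)) (s (tau j)).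
  by rewrite E in neq.
have := sD (tau i0) z0; rewrite -[s (tau i0)]/((s \o tau) i0) s_id => /le_trans; apply.
by rewrite ler_wpM2r// ler_wpM2r// ler_nat.
Qed.

End Estimator.

(** * Rates *)

Definition radius (R : realType) (M : nat -> R) (N : nat) : R :=
  Num.min (Num.sqrt (M N)) (Num.sqrt (Num.sqrt N%:R)).

(** The cap in [radius] keeps this at most [N^(-1/4)], hence vanishing, however fast [M] grows. *)
Definition tolerance (R : realType) (M : nat -> R) (N : nat) : R :=
  radius M N / Num.sqrt N%:R.

Section Rate.
Variables (R : realType) (M : nat -> R).
Hypothesis hM : M @ \oo --> +oo.

Lemma radius_gt (B : R) : \forall N \near \oo,
  B < Num.sqrt (M N) /\ B < Num.sqrt (Num.sqrt N%:R).
Proof.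
wlog B0 : B / 0 <= B.
  move=> H; have := H `|B| (normr_ge0 _); apply: filterS => N [h1 h2].
  by split; exact: le_lt_trans (ler_norm _) _.
have BM : \forall N \near \oo, B ^+ 2 < M N by move/cvgryPgt : hM; apply.
have BN : \forall N \near \oo, (B ^+ 2) ^+ 2 < N%:R :> R by exact: nbhs_infty_gtr.
near=> N; have B2M : B ^+ 2 < M N by near: N.
have B4N : (B ^+ 2) ^+ 2 < N%:R :> R by near: N.
have lt_sqrt (u v : R) : 0 <= u -> u ^+ 2 < v -> u < Num.sqrt v.
  by move=> u0 uv; rewrite -(ger0_norm u0) -sqrtr_sqr ltr_sqrt// (le_lt_trans _ uv)// sqr_ge0.
split; first exact: lt_sqrt.
by apply/lt_sqrt/lt_sqrt => //; exact: sqr_ge0.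
Unshelve. all: by end_near. Qed.

Lemma radius_tolerance (C r : R) : 0 < r -> \forall N \near \oo,
  [/\ 0 < tolerance M N, C * tolerance M N <= Num.sqrt (tolerance M N),
      tolerance M N < r, Num.sqrt (tolerance M N) < r &
      C * tolerance M N < M N / Num.sqrt N%:R].
Proof.
(* With [e] the tolerance and [q = N^(1/4)], so that [e <= q^-1]: [|C|] serves the last bound,
   [r^-1] gives [e < r], its square gives [Num.sqrt e < r], and [(|C| + 1)^2] gives
   [C * e <= Num.sqrt e]. *)
move=> r0; pose B := Num.max (`|C|) (Num.max r^-1 (Num.max (r^-1 ^+ 2) ((`|C| + 1) ^+ 2))).
have := radius_gt B; apply: filterS => N.
rewrite /tolerance /radius; set m := Num.sqrt (M N); set q := Num.sqrt (Num.sqrt N%:R).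
rewrite !gt_max => -[/andP[Cm _] /and4P[_ rq r2q C2q]].
have m0 : 0 < m by rewrite (le_lt_trans _ Cm).
have q0 : 0 < q by rewrite (lt_trans _ rq) ?invr_gt0.
have -> : Num.sqrt N%:R = q ^+ 2 :> R by rewrite sqr_sqrtr ?sqrtr_ge0.
have -> : M N = m ^+ 2 by rewrite sqr_sqrtr// ltW// -sqrtr_gt0.
set L := Num.min m q; set e := L / q ^+ 2.
have L0 : 0 < L by rewrite lt_min m0.
have Lm : L <= m by rewrite ge_min lexx.
have Lq : L <= q by rewrite ge_min lexx orbT.
have q20 : 0 < q ^+ 2 by rewrite exprn_gt0.
have e0 : 0 < e by rewrite divr_gt0.
have eq : e <= q^-1 by rewrite ler_pdivrMr// expr2 mulKf ?gt_eqF.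
have e_lt s : 0 < s -> s^-1 < q -> e < s.
  by move=> s0 sq; rewrite (le_lt_trans eq)// invf_plt.
have sqrt_lt s : 0 < s -> (s ^+ 2)^-1 < q -> Num.sqrt e < s.
  move=> s0 sq; rewrite -(gtr0_norm s0) -sqrtr_sqr ltr_sqrt ?exprn_gt0//.
  by rewrite e_lt// exprn_gt0.
split => //.
- have se : Num.sqrt e < (`|C| + 1)^-1.
    by rewrite sqrt_lt ?invr_gt0 ?ltr_wpDl// exprVn invrK.
  rewrite -{1}(sqr_sqrtr (ltW e0)) expr2 mulrA ler_piMl ?sqrtr_ge0//.
  apply: (@le_trans _ _ (`|C| * (`|C| + 1)^-1)).
    by rewrite (le_trans (ler_wpM2r (sqrtr_ge0 e) (ler_norm C)))// ler_wpM2l// ltW.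
  by rewrite ler_pdivrMr ?ltr_wpDl// mul1r lerDl.
- exact: e_lt.
- by rewrite sqrt_lt// -exprVn.
- rewrite mulrA ltr_pM2r ?invr_gt0// (le_lt_trans (ler_wpM2r (ltW L0) (ler_norm C)))//.
  by rewrite (le_lt_trans (ler_wpM2l (normr_ge0 C) Lm))// expr2 ltr_pM2r.
Qed.

(** [N] times the squared tolerance is the squared radius, which is unbounded; the 3 in [B] pays for
    [N <= 3 * (N - 2)]. *)
Lemma tolerance_cvg (K : R) : (fun N : nat => K / ((N - 2)%:R * tolerance M N ^+ 2)) @ \oo --> (0 : R).
Proof.
apply/cvgr0Pnorm_lt => eps eps0.
pose B := Num.max 1 (3 * `|K| / eps).
near=> N; have [Bm Bq] : B < Num.sqrt (M N) /\ B < Num.sqrt (Num.sqrt N%:R).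
  by near: N; exact: radius_gt.
have N3 : (2 < N)%N by near: N; exact: nbhs_infty_gt.
have N0 : 0 < N%:R :> R by rewrite ltr0n; lia.
have BL : B < radius M N by rewrite /radius lt_min Bm.
set L := radius M N in BL; move: BL; rewrite gt_max => /andP[L1 KL].
have n3 : N%:R <= 3 * (N - 2)%:R :> R by rewrite -natrM ler_nat; lia.
have n0 : 0 < (N - 2)%:R :> R by rewrite ltr0n; lia.
have -> : tolerance M N ^+ 2 = L ^+ 2 / N%:R.
  by rewrite /tolerance expr_div_n sqr_sqrtr// ltW.
have L2 : L < L ^+ 2 by rewrite expr2 ltr_pMr// (lt_trans _ L1).
have d0 : 0 < (N - 2)%:R * (L ^+ 2 / N%:R).
  by rewrite mulr_gt0// divr_gt0// exprn_gt0// (lt_trans _ L1).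
rewrite normrM normfV (gtr0_norm d0) ltr_pdivrMr//.
move: KL; rewrite ltr_pdivrMr// => KL.
rewrite mulrA mulrA ltr_pdivlMr//.
apply: (@le_lt_trans _ _ (`|K| * (3 * (N - 2)%:R))); first by rewrite ler_wpM2l.
have -> : `|K| * (3 * (N - 2)%:R) = 3 * `|K| * (N - 2)%:R :> R by ring.
rewrite [X in _ < X](_ : _ = L ^+ 2 * eps * (N - 2)%:R); last by ring.
by rewrite ltr_pM2r// (lt_trans KL)// ltr_pM2r.
Unshelve. all: by end_near. Qed.

End Rate.

(** * Convergence in probability of the fitted densities *)

Theorem theorem4 (R : realType) (J : nat) (hJ : (2 <= J)%N)
  (M : nat -> R) (hM : M @ \oo --> +oo) :
  exists fhat : forall N : nat, N.-tuple int -> 'I_J -> int -> R,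
  forall (Q : 'M[R]_J) (pi : 'rV[R]_J) (f : 'I_J -> int -> R),
    assumption_A2' Q pi -> assumption_A3 f ->
    exists tau : {perm 'I_J},
    forall j : 'I_J,
      (fun N : nat =>
         @hmm_prob R J Q pi f N
           [set x : N.-tuple int |
              ((M N / Num.sqrt N%:R)%:E <=
                 supnorm (fun z => (fhat N x j z - f (tau j) z)%R))%E])
        @ \oo --> 0%E.
Proof.
(* The slack, the square root of the tolerance, vanishes but eventually exceeds every multiple of
   the tolerance, so the unknown constant does not enter the estimator. *)
exists (fun N x => fit (tolerance M N) (Num.sqrt (tolerance M N)) x).
move=> Q pi f A2 A3; have [tau tau_lex] := lex_sorting_perm A3; exists tau => j.
have [C [r r0 Hfit]] := fit_close A2 A3 tau_lex.
case: (A2) => sQ _ iQ _ ipi.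
have pmf0 N (x : N.-tuple int) : (0 <= (hmm_pmf Q pi f x)%:E)%E.
  by rewrite lee_fin; apply: hmm_pmf_ge0 => //; exact: A3.1.
have [K K0 HK] := visits_deviation sQ iQ ipi A3.1.
pose g N := (K / ((N - 2)%:R * tolerance M N ^+ 2))%:E.
apply: (@squeeze_cvge _ _ _ _ (fun=> 0%E) _ g); last 2 first.
- exact: cvg_cst.
- by apply: cvg_EFin; [exact: nearW|exact: tolerance_cvg].
near=> N; apply/andP; split; first exact: esum_ge0.
have N3 : (2 < N)%N by near: N; exact: nbhs_infty_gt.
have [e0 Ceta er eta_r CeM] : [/\ 0 < tolerance M N,
    C * tolerance M N <= Num.sqrt (tolerance M N),
    tolerance M N < r, Num.sqrt (tolerance M N) < r &
    C * tolerance M N < M N / Num.sqrt N%:R].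
  by near: N; exact: radius_tolerance.
apply: le_trans (HK N (tolerance M N) N3 e0); rewrite /hmm_prob.
rewrite esum_mkcond [leRHS]esum_mkcond; apply: le_esum => x _.
case: ifPn => [|_]; last by case: ifP.
(* The bad event lies in the deviation event: if no pattern deviates, [Hfit] bounds the error by
   [C * tolerance M N], which is below the threshold. *)
rewrite inE /= => far; rewrite ifT// inE; apply: contrapT => /forallNP close.
have : (supnorm (fun z => fit (tolerance M N) (Num.sqrt (tolerance M N)) x j z
    - f (tau j) z)%R <= (C * tolerance M N)%:E)%E.
  apply: ge_ereal_sup => _ [z _ <-]; rewrite lee_fin; apply: Hfit => //.
    exact: ltW.
  by move=> u; rewrite leNgt; apply/negP => /ltW; exact: close.
by move/(le_trans far); rewrite lee_fin leNgt CeM.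
Unshelve. all: by end_near. Qed.
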